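(* Let $n,p\ge 1$, let $0<\mu\le L<\infty$, and let $f_1,\dots,f_n:\mathbb{R}^p\to\mathbb{R}$ be differentiable, $\mu$-strongly convex functions with $L$-Lipschitz continuous gradients. Let $x^*$ be the minimizer of $f=\frac1n\sum_{i=1}^n f_i$, let $\kappa=L/\mu$ and $\rho=(\kappa-1)/(\kappa+1)$. Let $(x^k)_{k\ge 0}$ be the sequence generated by the DIAG method from $x^0\in\mathbb{R}^p$ with stepsize $\epsilon=2/(\mu+L)$. Suppose the constants $a>0$ and $0\le\gamma<1$ satisfy $$\rho\left(1-\frac{(k-1)(1-\rho)}{n}\right)\le a\gamma^k\quad\text{for } k=1,\dots,n,$$ and $$\gamma^{n+1}-\left(1+\frac{\rho}{n}\right)\gamma^n+\frac{\rho}{n}\le 0.$$ Then for all $k\ge 1$, $$\|x^k-x^*\|\le a\gamma^k\|x^0-x^*\|.$$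
   Context: $\|\cdot\|$ is the Euclidean norm. A differentiable $f_i$ is $\mu$-strongly convex if $(\nabla f_i(x)-\nabla f_i(y))^T(x-y)\ge \mu\|x-y\|^2$ for all $x,y\in\mathbb{R}^p$; its gradient is $L$-Lipschitz if $\|\nabla f_i(x)-\nabla f_i(y)\|\le L\|x-y\|$ for all $x,y\in\mathbb{R}^p$. DIAG (Double Incremental Aggregated Gradient) method with stepsize $\epsilon$: given $x^0\in\mathbb{R}^p$, set $y_1^0=\dots=y_n^0=x^0$. For $k=0,1,2,\dots$, let $i^k=(k \bmod n)+1$, compute $$x^{k+1}=\frac1n\sum_{i=1}^n y_i^k-\frac{\epsilon}{n}\sum_{i=1}^n\nabla f_i(y_i^k),$$ and set $y_{i^k}^{k+1}=x^{k+1}$ and $y_i^{k+1}=y_i^k$ for $i\ne i^k$. *)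

(* Defs.v *)
From mathcomp Require Import all_boot all_order all_algebra.
From mathcomp Require Import all_classical all_reals all_analysis.
Set Implicit Arguments.
Unset Strict Implicit.
Unset Printing Implicit Defensive.
Import Order.TTheory GRing.Theory Num.Theory.
Import numFieldNormedType.Exports.
Local Open Scope ring_scope.

Definition inner (R : realType) (p : nat) (u v : 'cV[R]_p) : R :=
  (u^T *m v) 0 0.

(* The library norm on matrices is the sup norm, so the Euclidean norm is
   defined here. The two norms are equivalent, so the library's
   [differentiable] is the usual Frechet differentiability on R^p. *)
Definition enorm (R : realType) (p : nat) (u : 'cV[R]_p) : R :=
  Num.sqrt (inner u u).

Definition gradient (R : realType) (p : nat) (f : 'cV[R]_p -> R)
    (x : 'cV[R]_p) : 'cV[R]_p :=
  \col_(j < p) 'D_(delta_mx j 0) f x.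

Definition strongly_convex (R : realType) (p : nat) (mu : R)
    (f : 'cV[R]_p -> R) : Prop :=
  forall x y : 'cV[R]_p,
    mu * enorm (x - y) ^+ 2 <= inner (gradient f x - gradient f y) (x - y).

Definition lipschitz_gradient (R : realType) (p : nat) (L : R)
    (f : 'cV[R]_p -> R) : Prop :=
  forall x y : 'cV[R]_p,
    enorm (gradient f x - gradient f y) <= L * enorm (x - y).

Definition average (R : realType) (n p : nat) (f : 'I_n -> 'cV[R]_p -> R)
    (x : 'cV[R]_p) : R :=
  n%:R^-1 * \sum_(i < n) f i x.

Definition minimizer (R : realType) (p : nat) (f : 'cV[R]_p -> R)
    (xs : 'cV[R]_p) : Prop :=
  forall x : 'cV[R]_p, f xs <= f x.

Definition diag_update (R : realType) (n p : nat) (f : 'I_n -> 'cV[R]_p -> R)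
    (eps : R) (y : 'I_n -> 'cV[R]_p) : 'cV[R]_p :=
  n%:R^-1 *: \sum_(i < n) y i
  - (eps / n%:R) *: \sum_(i < n) gradient (f i) (y i).

(* Component functions are indexed from 0, so that step k refreshes the copy of
   index k mod n. *)
Fixpoint diag_y (R : realType) (n p : nat) (f : 'I_n -> 'cV[R]_p -> R)
    (eps : R) (x0 : 'cV[R]_p) (k : nat) : 'I_n -> 'cV[R]_p :=
  if k is k'.+1 then
    let y := diag_y f eps x0 k' in
    fun i => if val i == (k' %% n)%N then diag_update f eps y else y i
  else fun=> x0.

Definition diag_x (R : realType) (n p : nat) (f : 'I_n -> 'cV[R]_p -> R)
    (eps : R) (x0 : 'cV[R]_p) (k : nat) : 'cV[R]_p :=
  if k is k'.+1 then diag_update f eps (diag_y f eps x0 k') else x0.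

(* Main.v *)
(** With stepsize 2/(mu+L) the map z |-> z - eps * grad f_i(z) is a
    rho-contraction.  The gradients sum to zero at the minimizer xs, so the
    update is an average of n such maps, whence the errors e_k = |x^k - xs|
    satisfy e_(k+1) <= (rho/n) * (e_k + ... + e_(k-n+1)), with e_0 standing for
    negative indices.  The first hypothesis on a and gamma bounds the first n
    errors; the second, divided by 1-gamma, says that
    (rho/n) * (1 + gamma + ... + gamma^(n-1)) <= gamma^n, which propagates the
    bound through the recursion. *)

Require Import Defs.
From mathcomp Require Import all_boot all_order all_algebra.
From mathcomp Require Import all_classical all_reals all_analysis.
From mathcomp Require Import ring lra zify.
Import Order.TTheory GRing.Theory Num.Theory.
Import numFieldNormedType.Exports.
Local Open Scope ring_scope.
Set Implicit Arguments.
Unset Strict Implicit.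
Unset Printing Implicit Defensive.

(** * Euclidean inner product and norm *)

Section Euclidean.
Context {R : realType} {p : nat}.
Implicit Types (u v w : 'cV[R]_p) (c : R).

Lemma inner_sum u v : inner u v = \sum_j u j 0 * v j 0.
Proof. by rewrite /inner mxE; apply: eq_bigr => j _; rewrite mxE. Qed.

Lemma innerC u v : inner u v = inner v u.
Proof. by rewrite !inner_sum; apply: eq_bigr => j _; rewrite mulrC. Qed.

Lemma innerDr u v w : inner u (v + w) = inner u v + inner u w.
Proof. by rewrite /inner mulmxDr mxE. Qed.

Lemma innerZr c u v : inner u (c *: v) = c * inner u v.
Proof. by rewrite /inner -scalemxAr mxE. Qed.

Lemma innerNr u v : inner u (- v) = - inner u v.
Proof. by rewrite -scaleN1r innerZr mulN1r. Qed.

Lemma innerDl u v w : inner (u + v) w = inner u w + inner v w.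
Proof. by rewrite innerC innerDr !(innerC w). Qed.

Lemma innerZl c u v : inner (c *: u) v = c * inner u v.
Proof. by rewrite innerC innerZr innerC. Qed.

Lemma innerNl u v : inner (- u) v = - inner u v.
Proof. by rewrite innerC innerNr innerC. Qed.

Definition innerE := (innerDl, innerDr, innerNl, innerNr, innerZl, innerZr).

Lemma inner_suml (I : finType) (F : I -> 'cV[R]_p) v :
  inner (\sum_i F i) v = \sum_i inner (F i) v.
Proof.
elim/big_rec2: _ => [|i s u _ <-]; last by rewrite innerDl.
by rewrite -(scale0r v) innerZl mul0r.
Qed.

Lemma inner_ge0 u : 0 <= inner u u.
Proof. by rewrite inner_sum sumr_ge0 // => j _; rewrite -expr2 sqr_ge0. Qed.

Lemma inner_eq0 u : (inner u u == 0) = (u == 0).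
Proof.
apply/idP/eqP => [|->]; last by rewrite -(scale0r 0) innerZl mul0r.
rewrite inner_sum psumr_eq0 => [/allP u0|j _]; last by rewrite -expr2 sqr_ge0.
apply/matrixP => j k; rewrite ord1 mxE.
by have := u0 j (mem_index_enum _); rewrite /= mulf_eq0 orbb => /eqP.
Qed.

Lemma enorm_ge0 u : 0 <= enorm u.
Proof. exact: sqrtr_ge0. Qed.

Lemma sqr_enorm u : enorm u ^+ 2 = inner u u.
Proof. by rewrite /enorm sqr_sqrtr // inner_ge0. Qed.

Lemma enorm_le u c : 0 <= c -> (enorm u <= c) = (inner u u <= c ^+ 2).
Proof.
by move=> c0; rewrite -sqr_enorm ler_pXn2r // nnegrE enorm_ge0.
Qed.

Lemma enormZ c u : 0 <= c -> enorm (c *: u) = c * enorm u.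
Proof.
move=> c0; rewrite /enorm !innerE mulrA -expr2 sqrtrM ?sqr_ge0//.
by rewrite sqrtr_sqr ger0_norm.
Qed.

(** Cauchy-Schwarz: for nonzero [v], the squared norm of [inner v v *: u - inner u v *: v] is
    [inner v v] times the defect of the squared inequality. *)
Lemma inner_le_enorm u v : inner u v <= enorm u * enorm v.
Proof.
have [v0|vN0] := eqVneq v 0.
  by rewrite v0 -(scale0r 0) innerZr mul0r mulr_ge0 ?enorm_ge0.
have vv : 0 < inner v v by rewrite lt_def inner_eq0 vN0 inner_ge0.
apply: le_trans (ler_norm _) _.
rewrite -(@ler_pXn2r _ 2) ?nnegrE ?mulr_ge0 ?enorm_ge0//.
rewrite real_normK ?num_real// exprMn !sqr_enorm.
have := inner_ge0 (inner v v *: u - inner u v *: v).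
rewrite !innerE (innerC v u) => H.
rewrite -(ler_pM2l vv) -subr_ge0; apply: le_trans H _.
by rewrite le_eqVlt; apply/orP; left; apply/eqP; ring.
Qed.

Lemma enormD u v : enorm (u + v) <= enorm u + enorm v.
Proof.
rewrite enorm_le ?addr_ge0 ?enorm_ge0// sqrrD !sqr_enorm !innerE (innerC v u).
have := inner_le_enorm u v; lra.
Qed.

Lemma enorm_sum (I : finType) (F : I -> 'cV[R]_p) :
  enorm (\sum_i F i) <= \sum_i enorm (F i).
Proof.
elim/big_rec2: _ => [|i s u _ IH].
  by rewrite -(scale0r 0) enormZ// mul0r.
exact: le_trans (enormD _ _) (lerD (lexx _) IH).
Qed.

End Euclidean.

(** * Derivatives along a line *)

Section Calculus.
Context {R : realType} {p : nat}.
Implicit Types (f : 'cV[R]_p -> R) (x h : 'cV[R]_p).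

Lemma derive_gradient f x h :
  differentiable f x -> 'D_h f x = inner (gradient f x) h.
Proof.
move=> df; rewrite deriveE// {1}(matrix_sum_delta h) inner_sum linear_sum.
by apply: eq_bigr => j _; rewrite big_ord1 linearZ /= mxE deriveE// mulrC.
Qed.

Lemma is_derive_line f x h (t : R) : differentiable f (x + t *: h) ->
  is_derive t 1 (fun s => f (x + s *: h)) (inner (gradient f (x + t *: h)) h).
Proof.
move=> df.
(* The difference quotient of the restriction at [t] is the one defining the derivative of [f] at
   [x + t *: h] along [h]. *)
have shiftE : (fun s : R => s^-1 *:
    (((fun r => f (x + r *: h)) \o shift t) (s *: 1) - f (x + t *: h))) =
  (fun s : R => s^-1 *: ((f \o shift (x + t *: h)) (s *: h) - f (x + t *: h))).
  apply/funext => s /=; congr (_ *: (f _ - _)).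
  by rewrite /shift /= [s%:A]mulr1 scalerDl addrCA.
split.
  by rewrite /derivable shiftE; exact: diff_derivable.
by rewrite -derive_gradient// /derive shiftE.
Qed.

(** The mean value theorem for [f] along the segment minus a quadratic with free coefficient [c].
    Taking [c] to be [L] or [mu] times [inner h h] makes the right-hand side nonpositive or
    nonnegative, so one identity serves both quadratic bounds. *)
Lemma taylor2_line f x h (c : R) : (forall y, differentiable f y) ->
  exists2 t : R, 0 < t &
    f (x + h) - f x - inner (gradient f x) h - c / 2 =
    inner (gradient f (x + t *: h) - gradient f x) h - t * c.
Proof.
move=> df.
pose a := inner (gradient f x) h.
pose g (s : R) := f (x + s *: h) - (a * s + c / 2 * s ^+ 2).
have dg (t : R) :
    is_derive t 1 g (inner (gradient f (x + t *: h)) h - (a + t * c)).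
  have dq := is_deriveD (is_deriveZ a (is_derive_id t 1))
                        (is_deriveZ (c / 2) (is_deriveX 2 (is_derive_id t 1))).
  have db := is_deriveB (is_derive_line (df (x + t *: h))) dq.
  have <- : inner (gradient f (x + t *: h)) h -
      (a *: 1 + (c / 2) *: ((2%:R * id t ^+ 2.-1) *: 1)) =
      inner (gradient f (x + t *: h)) h - (a + t * c).
    by rewrite /GRing.scale /=; lra.
  exact: db.
have [t /[!in_itv]/= /andP[t0 _]] : exists2 t : R, t \in `]0, 1[%R & g 1 - g 0 =
    (inner (gradient f (x + t *: h)) h - (a + t * c)) * (1 - 0).
  apply: MVT => //; apply: derivable_within_continuous => t _.
  exact: ex_derive.
rewrite /g !scale1r scale0r addr0 => gE; exists t => //.
rewrite !innerE -/a; lra.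
Qed.

End Calculus.

(** * Quadratic bounds and contraction of the gradient step *)

Section SmoothStronglyConvex.
Context {R : realType} {p : nat} (mu L : R) (f : 'cV[R]_p -> R).
Hypothesis f_diff : forall x, differentiable f x.
Implicit Types x y h : 'cV[R]_p.

Lemma lipschitz_upper x h : lipschitz_gradient L f ->
  f (x + h) <= f x + inner (gradient f x) h + L / 2 * inner h h.
Proof.
move=> f_lip; have [t t0 E] := @taylor2_line _ _ f x h (L * inner h h) f_diff.
have := inner_le_enorm (gradient f (x + t *: h) - gradient f x) h.
have := ler_wpM2r (enorm_ge0 h) (f_lip (x + t *: h) x).
rewrite addrAC subrr add0r enormZ ?(ltW t0)// -!mulrA -expr2 sqr_enorm.
lra.
Qed.

(** Strong convexity between [x + t *: h] and [x] carries a spare factor [t] on both sides; it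
    cancels because [t] is positive. *)
Lemma strongly_convex_lower x h : strongly_convex mu f ->
  f x + inner (gradient f x) h + mu / 2 * inner h h <= f (x + h).
Proof.
move=> f_sc; have [t t0 E] := @taylor2_line _ _ f x h (mu * inner h h) f_diff.
have := f_sc (x + t *: h) x.
rewrite addrAC subrr add0r sqr_enorm [X in _ <= X]innerZr !innerZl innerZr => H.
have : t * (mu * inner h h) <= inner (gradient f (x + t *: h) - gradient f x) h.
  rewrite -(ler_pM2l t0); apply: le_trans H; rewrite le_eqVlt.
  by apply/orP; left; apply/eqP; ring.
lra.
Qed.

Hypothesis mu_gt0 : 0 < mu.
Hypothesis mu_le_L : mu <= L.
Hypothesis f_sc : strongly_convex mu f.
Hypothesis f_lip : lipschitz_gradient L f.

(** Uses both curvature bounds at once; this is what yields the sharp factor [rho] in the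
    contraction. *)
Lemma gradient_coercive x y :
  mu * L * inner (x - y) (x - y)
  + inner (gradient f x - gradient f y) (gradient f x - gradient f y)
  <= (mu + L) * inner (gradient f x - gradient f y) (x - y).
Proof.
move gE : (gradient f x - gradient f y) => g; move dE : (x - y) => d.
(* The general argument divides by [L - mu]. If [mu = L], both terms on the left are at most
   [mu ^+ 2 * inner d d], and strong convexity concludes. *)
have [muL|] := eqVneq mu L.
  have gg : inner g g <= mu ^+ 2 * inner d d.
    rewrite -!sqr_enorm -exprMn ler_pXn2r ?nnegrE ?mulr_ge0 ?enorm_ge0//.
      by rewrite muL -gE -dE; exact: f_lip.
    exact: ltW.
  have gd : mu * inner d d <= inner g d.
    by rewrite -sqr_enorm -gE -dE; exact: f_sc.
  have := ler_wpM2l (ltW mu_gt0) gd; rewrite -muL; lra.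
rewrite neq_lt [L < mu]ltNge mu_le_L orbF -subr_gt0 => Lmu.
(* Compare the lower bound at one of [x], [y] with the upper bound at the other
   in the common point [y + w], then exchange the roles with [x - w] and add;
   the best [w] is the one substituted below. *)
have key (w : 'cV[R]_p) :
    2 * inner g w + mu * inner (w - d) (w - d) - L * inner w w <= inner g d.
  have xE : x + (w - d) = y + w.
    by rewrite -dE; apply/matrixP => i j; rewrite !mxE; ring.
  have yE : y + (d - w) = x - w.
    by rewrite -dE; apply/matrixP => i j; rewrite !mxE; ring.
  have := strongly_convex_lower x (w - d) f_sc; rewrite xE.
  have := lipschitz_upper y w f_lip.
  have := strongly_convex_lower y (d - w) f_sc; rewrite yE.
  have := lipschitz_upper x (- w) f_lip.
  by rewrite -gE !innerE (innerC d w); lra.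
have := key ((L - mu)^-1 *: (g - mu *: d)).
rewrite -(ler_pM2l Lmu) !innerE (innerC d g) => H.
rewrite -subr_ge0; rewrite -subr_ge0 in H; apply: le_trans H _.
rewrite le_eqVlt; apply/orP; left; apply/eqP; field.
by rewrite gt_eqF.
Qed.

(** Expand the square of [d - eps *: g]. Since [eps * (mu + L) = 2], coercivity times [eps ^+ 2]
    absorbs the cross term and [inner g g], leaving the factor [1 - eps ^+ 2 * (mu * L)], which is
    the square of [rho]. *)
Lemma gradient_step_contraction x y :
  enorm (x - (2 / (mu + L)) *: gradient f x
         - (y - (2 / (mu + L)) *: gradient f y))
  <= (L / mu - 1) / (L / mu + 1) * enorm (x - y).
Proof.
have mL : 0 < mu + L by rewrite addr_gt0// (lt_le_trans mu_gt0).
have -> : (L / mu - 1) / (L / mu + 1) = (L - mu) / (mu + L).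
  by field; rewrite ?gt_eqF//= addrC gt_eqF.
set eps := 2 / (mu + L).
have -> : x - eps *: gradient f x - (y - eps *: gradient f y)
        = (x - y) - eps *: (gradient f x - gradient f y).
  by apply/matrixP => i j; rewrite !mxE; ring.
have := gradient_coercive x y.
move gE : (gradient f x - gradient f y) => g; move dE : (x - y) => d coer.
rewrite enorm_le ?mulr_ge0 ?invr_ge0 ?subr_ge0 ?enorm_ge0 ?(ltW mL)//.
rewrite exprMn sqr_enorm !innerE (innerC d g).
have := ler_wpM2l (sqr_ge0 eps) coer.
have -> : ((L - mu) / (mu + L)) ^+ 2 = 1 - eps ^+ 2 * (mu * L).
  by rewrite /eps; field; rewrite gt_eqF.
have -> : eps ^+ 2 * ((mu + L) * inner g d) = 2 * eps * inner g d.
  by rewrite /eps; field; rewrite gt_eqF.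
lra.
Qed.

End SmoothStronglyConvex.

(** * First-order optimality at the minimizer *)

Lemma sum_gradient_minimizer (R : realType) (n p : nat) (L : R)
    (f : 'I_n -> 'cV[R]_p -> R) (xs : 'cV[R]_p) :
  0 < L -> (forall i x, differentiable (f i) x) ->
  (forall i, lipschitz_gradient L (f i)) -> minimizer (average f) xs ->
  \sum_i gradient (f i) xs = 0.
Proof.
case: n f => [|n] f L0 f_diff f_lip xs_min; first by rewrite big_ord0.
set G := \sum_i _; apply/eqP; rewrite -inner_eq0 eq_le inner_ge0 andbT.
have n0 : 0 < n.+1%:R :> R by rewrite ltr0n.
(* A gradient step from [xs] would decrease the average unless [G = 0]. *)
pose t := (n.+1%:R * L)^-1.
have := xs_min (xs - t *: G); rewrite /average ler_pM2l ?invr_gt0// => le_sum.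
have : \sum_i f i (xs - t *: G) <=
    \sum_i (f i xs + inner (gradient (f i) xs) (- (t *: G))
             + L / 2 * inner (- (t *: G)) (- (t *: G))).
  by apply: ler_sum => i _; exact: lipschitz_upper.
move=> /(le_trans le_sum); rewrite !big_split /= -inner_suml -/G.
rewrite sumr_const card_ord.
rewrite -[_ *+ n.+1]mulr_natl.
move gE : (inner G G) => g; rewrite !innerE opprK gE.
(* This choice of [t] makes the quadratic term half of the linear decrease [t * g], so minimality
   forces [g <= 0]. *)
have -> : n.+1%:R * (L / 2 * (t * (t * g))) = t * g / 2.
  by rewrite /t; field; rewrite gt_eqF//= nat1r pnatr_eq0.
have t0 : 0 < t by rewrite invr_gt0 mulr_gt0.
by rewrite -(pmulr_rle0 g t0); lra.
Qed.

(** * The stored copies as a window of recent iterates *)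

Section Iterates.
Context {R : realType} {n p : nat} (f : 'I_n.+1 -> 'cV[R]_p -> R) (eps : R).
Context (x0 : 'cV[R]_p).

(* Truncated subtraction makes the right-hand side [x0] for the copies that are
   not refreshed yet. *)
Lemma diag_yE k (i j : 'I_n.+1) : i = ((k + j) %% n.+1)%N :> nat ->
  diag_y f eps x0 k i = diag_x f eps x0 (k + j - n)%N.
Proof.
elim: k i j => [|k IH] i j iE /=.
  by rewrite (eqP (_ : 0 + j - n == 0)%N)// add0n subn_eq0 -ltnS.
(* [j = n] is the copy refreshed in passing from [k] to [k.+1]. For smaller [j] the copy is kept,
   and its offset at time [k] is [j.+1]. *)
have := ltn_ord j; rewrite ltnS leq_eqVlt => /predU1P[jn|jn].
  by rewrite iE jn addnK addSnnS modnDr eqxx.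
rewrite ifN.
  have j1 : (j.+1 < n.+1)%N by [].
  by rewrite (IH i (Ordinal j1)) /= -addSnnS.
rewrite iE addSnnS; apply/eqP => /eqP.
by rewrite -{2}[k]addn0 eqn_modDl !modn_small.
Qed.

(** Modulo [n.+1], the shift of [j] by [k] permutes the indices, so the cyclic order of the copies
    does not affect the sum. *)
Lemma sum_diag_y (F : 'cV[R]_p -> R) k :
  \sum_i F (diag_y f eps x0 k i) =
  \sum_(j < n.+1) F (diag_x f eps x0 (k + j - n)%N).
Proof.
have rP (j : 'I_n.+1) : ((k + j) %% n.+1 < n.+1)%N by rewrite ltn_pmod.
pose r j := Ordinal (rP j).
have r_inj : injective r.
  move=> i j /(congr1 val)/= /eqP; rewrite eqn_modDl !modn_small// => /eqP.
  exact: val_inj.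
rewrite (reindex_inj r_inj); apply: eq_bigr => j _.
by rewrite (@diag_yE k (r j) j).
Qed.

End Iterates.

(** * Decay of a nonnegative sequence bounded by window averages *)

Section Recursion.
Context {R : realType} (n : nat) (rho : R) (e : nat -> R).
Hypothesis rho_ge0 : 0 <= rho.
Hypothesis rho_le1 : rho <= 1.
Hypothesis e_ge0 : forall k, 0 <= e k.
Hypothesis e_rec : forall k,
  e k.+1 <= rho / n.+1%:R * \sum_(j < n.+1) e (k + j - n)%N.

(** The window at [k] holds [n.+1 - k] copies of [e 0] and the terms [e 1] to [e k], each at most
    [rho * e 0] by strong induction. *)
Lemma averaged_recursion_first_pass k : (k <= n)%N ->
  e k.+1 <= rho * (1 - k%:R * (1 - rho) / n.+1%:R) * e 0.
Proof.
have n0 : 0 < n.+1%:R :> R by rewrite ltr0n.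
elim/ltn_ind: k => k IH kn.
have le_rho j : (j < k)%N -> e j.+1 <= rho * e 0.
  move=> jk; apply: le_trans (IH j jk (leq_trans (ltnW jk) kn)) _.
  rewrite ler_wpM2r// ler_piMr// lerBlDr lerDl.
  by rewrite !mulr_ge0 ?invr_ge0 ?subr_ge0 ?ler0n.
apply: le_trans (e_rec k) _.
rewrite -(big_mkord xpredT (fun j => e (k + j - n)%N)).
rewrite (big_cat_nat _ (n := n.+1 - k))//= ?leq_subr//.
(* For these [j] the truncated subtraction gives index 0. *)
have s1 : \sum_(0 <= j < n.+1 - k) e (k + j - n)%N = e 0 *+ (n.+1 - k).
  rewrite (eq_big_nat _ _ (F2 := fun=> e 0%N)) ?sumr_const_nat ?subn0// => j jk.
  by congr e; lia.
have s2 : \sum_(n.+1 - k <= j < n.+1) e (k + j - n)%N <= (rho * e 0%N) *+ k.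
  have -> : (rho * e 0%N) *+ k = \sum_(n.+1 - k <= j < n.+1) rho * e 0%N.
    by rewrite sumr_const_nat subKn// leqW.
  rewrite big_nat_cond [X in _ <= X]big_nat_cond.
  apply: ler_sum => j /andP[jk _].
  have -> : (k + j - n = (k + j - n).-1.+1)%N by lia.
  by apply: le_rho; lia.
have -> : rho * (1 - k%:R * (1 - rho) / n.+1%:R) * e 0%N =
    rho / n.+1%:R * ((n.+1%:R - k%:R) * e 0%N + k%:R * (rho * e 0%N)).
  by field; rewrite nat1r pnatr_eq0.
rewrite s1 -natrB ?leqW// !mulr_natl ler_wpM2l ?lerD2l//.
by rewrite mulr_ge0 ?invr_ge0.
Qed.

Lemma averaged_recursion_linear (a gamma : R) :
  0 <= a -> 0 <= gamma -> gamma < 1 ->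
  (forall k, (1 <= k <= n.+1)%N ->
     rho * (1 - (k%:R - 1) * (1 - rho) / n.+1%:R) <= a * gamma ^+ k) ->
  gamma ^+ n.+2 - (1 + rho / n.+1%:R) * gamma ^+ n.+1 + rho / n.+1%:R <= 0 ->
  forall k, (1 <= k)%N -> e k <= a * gamma ^+ k * e 0%N.
Proof.
move=> a0 g0 g1 init gamma_root.
have geom : rho / n.+1%:R * \sum_(j < n.+1) gamma ^+ j <= gamma ^+ n.+1.
  have g1' : 0 < 1 - gamma by rewrite subr_gt0.
  have gsum : (1 - gamma) * \sum_(j < n.+1) gamma ^+ j = 1 - gamma ^+ n.+1.
    by have := subrX1 gamma n.+1; lra.
  rewrite -(ler_pM2l g1') mulrCA gsum.
  move: gamma_root; rewrite (exprS gamma n.+1).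
  move: (gamma ^+ n.+1) (rho / n.+1%:R) => X r.
  lra.
elim/ltn_ind => -[//|k] IH _.
have [kn|nk] := leqP k n.
  apply: le_trans (averaged_recursion_first_pass kn) _.
  rewrite ler_wpM2r//; have := init k.+1; rewrite -natr1 addrK; exact.
apply: le_trans (e_rec k) _.
have -> : (k = (k - n.+1) + n.+1)%N by rewrite subnK.
(* The window now runs from [m.+1] to [m + n.+1]. Index 0 is excluded, as it must be: the claimed
   bound can fail there when [a < 1]. *)
set m := (k - n.+1)%N.
have : \sum_(j < n.+1) e (m + n.+1 + j - n)%N <=
       \sum_(j < n.+1) (a * gamma ^+ m.+1 * e 0%N) * gamma ^+ j.
  apply: ler_sum => j _.
  have -> : (m + n.+1 + j - n = m.+1 + j)%N by lia.
  rewrite mulrAC -[a * _ * _]mulrA -exprD; apply: IH => //.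
  by have := ltn_ord j; rewrite /m; lia.
rewrite -mulr_sumr => H.
have w0 : 0 <= rho / n.+1%:R by rewrite mulr_ge0 ?invr_ge0.
apply: le_trans (ler_wpM2l w0 H) _.
rewrite mulrCA.
have -> : a * gamma ^+ (m + n.+1).+1 * e 0%N =
          (a * gamma ^+ m.+1 * e 0%N) * gamma ^+ n.+1.
  by rewrite -addSn exprD; ring.
by rewrite ler_wpM2l// !mulr_ge0 ?exprn_ge0.
Qed.

End Recursion.

(** * Linear convergence of the DIAG iterates *)

Theorem theorem4 (R : realType) (n p : nat) (n_ge1 : (1 <= n)%N)
    (p_ge1 : (1 <= p)%N) (mu L : R) (mu_gt0 : 0 < mu) (mu_le_L : mu <= L)
    (f : 'I_n -> 'cV[R]_p -> R)
    (f_diff : forall (i : 'I_n) (x : 'cV[R]_p), differentiable (f i) x)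
    (f_sc : forall i : 'I_n, strongly_convex mu (f i))
    (f_lip : forall i : 'I_n, lipschitz_gradient L (f i))
    (xs : 'cV[R]_p) (xs_min : minimizer (average f) xs)
    (x0 : 'cV[R]_p) (a gamma : R)
    (a_gt0 : 0 < a) (gamma_ge0 : 0 <= gamma) (gamma_lt1 : gamma < 1) :
  let kappa := L / mu in
  let rho := (kappa - 1) / (kappa + 1) in
  let eps := 2 / (mu + L) in
  let x := diag_x f eps x0 in
  (forall k : nat, (1 <= k <= n)%N ->
     rho * (1 - (k%:R - 1) * (1 - rho) / n%:R) <= a * gamma ^+ k) ->
  gamma ^+ n.+1 - (1 + rho / n%:R) * gamma ^+ n + rho / n%:R <= 0 ->
  forall k : nat, (1 <= k)%N ->
    enorm (x k - xs) <= a * gamma ^+ k * enorm (x0 - xs).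
Proof.
case: n n_ge1 f f_diff f_sc f_lip xs_min => // n _ f f_diff f_sc f_lip xs_min.
move=> kappa rho eps x init gamma_root.
have L0 : 0 < L by exact: lt_le_trans mu_le_L.
have kappa1 : 1 <= kappa by rewrite ler_pdivlMr// mul1r.
have rho0 : 0 <= rho by rewrite divr_ge0//; lra.
have rho1 : rho <= 1 by rewrite ler_pdivrMr; lra.
have sum0 := sum_gradient_minimizer L0 f_diff f_lip xs_min.
pose e k := enorm (x k - xs).
apply: (averaged_recursion_linear rho0 rho1 (e := e)) (ltW a_gt0) gamma_ge0
  gamma_lt1 init gamma_root => k.
  exact: enorm_ge0.
(* The window sum of past errors becomes the sum of the errors of the stored copies, which can be
   compared term by term with the update. *)
rewrite /e -(sum_diag_y f eps x0 (fun z => enorm (z - xs))).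
have n0 : 0 < n.+1%:R^-1 :> R by rewrite invr_gt0 ltr0n.
set y := diag_y f eps x0 k.
(* By [sum0], the terms [eps *: gradient (f i) xs] can be inserted at no cost, pairing each gradient
   step at [y i] with the one at [xs]. *)
have -> : x k.+1 - xs = n.+1%:R^-1 *:
    \sum_i (y i - eps *: gradient (f i) (y i)
            - (xs - eps *: gradient (f i) xs)).
  rewrite !sumrB -!scaler_sumr sum0 scaler0 subr0 sumr_const card_ord.
  rewrite -[xs *+ _]scaler_nat !scalerBr !scalerA mulVf ?pnatr_eq0// scale1r.
  by rewrite /x /= /diag_update -/y (mulrC eps).
rewrite (enormZ _ (ltW n0)) [rho / _]mulrC -mulrA ler_pM2l// mulr_sumr.
apply: le_trans (enorm_sum _) _; apply: ler_sum => i _.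
exact: gradient_step_contraction.
Qed.
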